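(* Let $\mathcal{C}^1 = \mathcal{C}(I^1_1,g^1), \ldots, \mathcal{C}^n = \mathcal{C}(I^n_1,g^n)$ be Cantor sets with density ratios equal to $x_1, \ldots, x_n$ respectively, such that $$\sum_{i=1}^n \frac{x_i}{x_i+1} \ge 1$$ and for all $j,k$, $$|I^j_1| \ge \frac{x_j}{x_j+1}\cdot\frac{x_k+1}{2x_k+1}\,|I^k_1|.$$ Then $\sum_{i=1}^n I^i_1 = \{\sum_{i=1}^n y_i : y_i \in \mathcal{C}^i\}$.
   Context: For an interval $I$ with endpoints $a<b$ write $|I| = b-a$. A Cantor set $\mathcal{C}(I_1, g)$ is given by a closed interval $I_1$ of positive length and a gap function $g$: recursively, for every constructed interval $I_i$, $g(I_i)$ is an open subinterval of $I_i$ with $I_i = I_{2i} \cup g(I_i) \cup I_{2i+1}$ disjointly, where $I_{2i}, I_{2i+1}$ are closed intervals of positive length to the left and right of the gap; the Cantor set is $I_1 \setminus \bigcup_i g(I_i)$. Its density ratio is $\inf_i \min(|I_{2i}|,|I_{2i+1}|)/|g(I_i)|$. Sums of intervals are pointwise: $[a_l,a_r]+[b_l,b_r]=[a_l+b_l,a_r+b_r]$. *)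

(* Defs.v *)
From Corelib Require Import BinNums.
From mathcomp Require Import all_boot all_order all_algebra.
From mathcomp Require Import all_classical all_reals.
Set Implicit Arguments.
Unset Strict Implicit.
Unset Printing Implicit Defensive.

Import Order.TTheory GRing.Theory Num.Theory.
Local Open Scope classical_set_scope.
Local Open Scope ring_scope.

Section CantorSets.
Variable R : realType.

(* An interval is given by its pair of endpoints; whether it is read as closed
   (the bridges I_i) or open (the gaps) is decided by clitv and opitv. *)
Implicit Types I J : R * R.

Definition clitv J : set R := [set` `[J.1, J.2]].
Definition opitv J : set R := [set` `]J.1, J.2[].
Definition itvlen J : R := J.2 - J.1.

(* A gap function sends a closed interval to its gap. It is total here, but
   only its values on the constructed intervals matter. *)
Implicit Type g : R * R -> R * R.

(* The binary index i >= 1 is a positive: xO i is 2i and xI i is 2i + 1. *)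
Fixpoint bridge I1 g (i : positive) : R * R :=
  match i with
  | xH => I1
  | xO i' => ((bridge I1 g i').1, (g (bridge I1 g i')).1)
  | xI i' => ((g (bridge I1 g i')).2, (bridge I1 g i').2)
  end.

Definition gap I1 g (i : positive) : R * R := g (bridge I1 g i).

(* For I_i = [a, b] and g(I_i) = ]c, d[ the condition is a < c < d < b: then
   [a, b] is the disjoint union of [a, c], ]c, d[ and [d, b], where the gap is
   nonempty and both closed pieces have positive length. *)
Definition is_cantor_data I1 g : Prop :=
  I1.1 < I1.2 /\
  forall i : positive,
    [/\ (bridge I1 g i).1 < (gap I1 g i).1,
        (gap I1 g i).1 < (gap I1 g i).2
      & (gap I1 g i).2 < (bridge I1 g i).2].

Definition cantor_set I1 g : set R :=
  clitv I1 `\` \bigcup_(i in [set: positive]) opitv (gap I1 g i).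

(* For Cantor data the ratios form a nonempty set of positive reals, so inf is
   a genuine infimum. *)
Definition density_ratio I1 g : R :=
  inf [set Num.min (itvlen (bridge I1 g (xO i))) (itvlen (bridge I1 g (xI i)))
             / itvlen (gap I1 g i) | i in [set: positive]].

End CantorSets.

(* Main.v *)
Require Import Defs.
From Corelib Require Import BinNums.
From mathcomp Require Import all_boot all_order all_algebra finmap.
From mathcomp Require Import all_classical all_reals.
From mathcomp Require Import topology normedtype ring lra.
Set Implicit Arguments.
Unset Strict Implicit.
Unset Printing Implicit Defensive.

Import Order.TTheory GRing.Theory Num.Theory.
Import numFieldNormedType.Exports.
Local Open Scope classical_set_scope.
Local Open Scope ring_scope.

(** Two gaps of a Cantor set of density ratio [x] are at distance at least [x]
    times the length of the shorter one, so removing gaps in decreasing order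
    of length keeps every remaining gap at distance [x * |gap|] from the ends
    of the interval around it. Remove finitely many gaps from all the Cantor
    sets, always taking the one, in the [k]-th set say, for which
    [M = (x k + 1) * |gap|] is largest. Along the way every current interval
    [J j] keeps length at least [x j / (x j + 1) * M]: this is the length
    hypothesis at the start, because [(2 * x k + 1) * |gap| <= |I1 k|], and it
    is preserved since a bridge next to the removed gap has length at least
    [x k * |gap| = x k / (x k + 1) * M] while [M] decreases. As the numbers
    [x j / (x j + 1)] add up to at least [1], the intervals other than [J k]
    have total length at least [|gap|], so that [s] remains in the sum of the
    intervals after one of the two bridges is chosen. Compactness then deals
    with all the gaps at once. *)

Local Notation len J := (J.2 - J.1).
Local Notation closed_itv J := `[J.1, J.2].
Local Notation open_itv J := `]J.1, J.2[.

Section Intervals.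
Variable R : realDomainType.
Implicit Types (r y : R) (G H J K L : R * R).

Definition inset r J K : bool := (K.1 + r <= J.1) && (J.2 + r <= K.2).

Definition apart r J K : bool := (J.2 + r <= K.1) || (K.2 + r <= J.1).

Definition is_bridge J G K : Prop := K = (J.1, G.1) \/ K = (G.2, J.2).

Lemma apartC r J K : apart r J K = apart r K J.
Proof. exact: orbC. Qed.

Lemma le_apart r r' J K : r <= r' -> apart r' J K -> apart r J K.
Proof. by rewrite /apart; lra. Qed.

Lemma le_inset r r' J K : r <= r' -> inset r' J K -> inset r J K.
Proof. by rewrite /inset; lra. Qed.

Lemma inset_trans r J K L : inset r J K -> inset 0 K L -> inset r J L.
Proof. by rewrite /inset; lra. Qed.

Lemma inset_apart r J K L : inset r J K -> apart 0 K L -> apart r J L.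
Proof. by rewrite /inset /apart; lra. Qed.

Lemma inset_not_apart J K : J.1 < J.2 -> inset 0 J K -> ~~ apart 0 J K.
Proof. by rewrite /inset /apart; lra. Qed.

Lemma le_len_inset r J K : inset r J K -> len J + 2 * r <= len K.
Proof. by rewrite /inset; lra. Qed.

Lemma mem_inset y J K : inset 0 J K -> y \in closed_itv J -> y \in closed_itv K.
Proof. by rewrite /inset !in_itv/=; lra. Qed.

Lemma apart_notin_open y J K :
  apart 0 J K -> y \in closed_itv K -> y \notin open_itv J.
Proof. by rewrite /apart !in_itv/=; lra. Qed.

Lemma inset_bridge J G K :
  G.1 <= G.2 -> inset 0 G J -> is_bridge J G K -> inset 0 K J.
Proof. by rewrite /inset => + + [->|->] /=; lra. Qed.

Lemma apart_bridge J G K : is_bridge J G K -> apart 0 G K.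
Proof. by rewrite /apart => -[->|->] /=; lra. Qed.

Lemma le_len_bridge r J G K : inset r G J -> is_bridge J G K -> r <= len K.
Proof. by rewrite /inset => + [->|->] /=; lra. Qed.

Lemma bridge_inset_or_apart r J G K H : 0 <= r -> G.1 <= G.2 ->
  is_bridge J G K -> inset r H J -> apart r H G ->
  inset r H K || apart 0 H K.
Proof. by rewrite /inset /apart => + + [->|->] /=; lra. Qed.

End Intervals.

Section SumsOfIntervals.
Variables (R : realFieldType) (I : finType).
Implicit Types (J : I -> R * R) (y : I -> R) (G : R * R) (s : R).

Definition sum_itv J : R * R := (\sum_i (J i).1, \sum_i (J i).2).

Lemma mem_sum_itv J y : (forall i, y i \in closed_itv (J i)) ->
  \sum_i y i \in closed_itv (sum_itv J).
Proof.
move=> yJ; rewrite in_itv/=; apply/andP.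
by split; apply: ler_sum => i _; have := yJ i; rewrite in_itv/= => /andP[].
Qed.

Lemma sum_itv_decompose J s : (forall i, (J i).1 <= (J i).2) ->
  s \in closed_itv (sum_itv J) ->
  exists2 y, forall i, y i \in closed_itv (J i) & s = \sum_i y i.
Proof.
move=> leJ; rewrite in_itv/= => /andP[]; set a := \sum_i _; set b := \sum_i _.
move=> le_as le_sb.
(* If [a = b] then [t = 0], which is right because [s = a]. *)
pose t := (s - a) / (b - a).
have t_ge0 : 0 <= t by apply: divr_ge0; lra.
have [t_le1 st] : t <= 1 /\ s = a + t * (b - a).
  rewrite /t; have [eq_ab|ne_ab] := eqVneq (b - a) 0.
    by rewrite eq_ab invr0 !mulr0; lra.
  have lt_ab : 0 < b - a by rewrite lt_neqAle eq_sym ne_ab; lra.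
  by rewrite ler_pdivrMr ?divfK//; lra.
exists (fun i => (J i).1 + t * len (J i)) => [i|].
  by rewrite in_itv/=; have := leJ i; nra.
by rewrite big_split/= -mulr_sumr sumrB.
Qed.

(* The hypothesis on [len G] says that the sums through the two bridges of [G]
   overlap. *)
Lemma sum_itv_remove_gap J k G s :
  len G <= \sum_(j | j != k) len (J j) -> s \in closed_itv (sum_itv J) ->
  exists2 K, is_bridge (J k) G K &
    s \in closed_itv (sum_itv [eta J with k |-> K]).
Proof.
have sumE K : sum_itv [eta J with k |-> K] =
    (K.1 + \sum_(j | j != k) (J j).1, K.2 + \sum_(j | j != k) (J j).2).
  rewrite /sum_itv !(bigD1 k (isT : xpredT k))/= eqxx.
  by congr (_ + _, _ + _); apply: eq_bigr => j /negPf ->.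
rewrite sumrB => len_le s_in.
rewrite in_itv/= !(bigD1 k (isT : xpredT k))/= in s_in.
have [s_le|s_gt] := leP s (G.1 + \sum_(j | j != k) (J j).2).
- by exists ((J k).1, G.1); [left | rewrite sumE in_itv/=; lra].
- by exists (G.2, (J k).2); [right | rewrite sumE in_itv/=; lra].
Qed.

End SumsOfIntervals.

Section GapFamilies.
Variables (R : realFieldType) (I P : Type) (x : I -> R) (G : I -> P -> R * R).

Record thick_gaps : Prop := {
  ratio_ge0 : forall i, 0 <= x i;
  gap_lt : forall i p, (G i p).1 < (G i p).2;
  gaps_apart : forall i p q, p <> q ->
    apart (x i * Num.min (len (G i p)) (len (G i q))) (G i p) (G i q) }.

Definition weight i p : R := (x i + 1) * len (G i p).

Record admissible (J : I -> R * R) : Prop := {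
  admissible_le : forall i, (J i).1 <= (J i).2;
  gap_inset_or_apart : forall i p,
    inset (x i * len (G i p)) (G i p) (J i) || apart 0 (G i p) (J i);
  le_len_admissible : forall j k p, inset 0 (G k p) (J k) ->
    x j / (x j + 1) * weight k p <= len (J j) }.

Definition gap_avoiding (J : I -> R * R) (y : I -> R) : Prop :=
  forall i, y i \in closed_itv (J i) /\ forall p, y i \notin open_itv (G i p).

Hypothesis thick : thick_gaps.

Lemma ratio_len_ge0 i p : 0 <= x i * len (G i p).
Proof. by have := ratio_ge0 thick i; have := gap_lt thick i p; nra. Qed.

Lemma ratio_weight i p : x i / (x i + 1) * weight i p = x i * len (G i p).
Proof. by have := ratio_ge0 thick i => ?; rewrite /weight; field; lra. Qed.

Lemma admissible_inset J i p : admissible J -> inset 0 (G i p) (J i) ->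
  inset (x i * len (G i p)) (G i p) (J i).
Proof.
move=> adm GJ; have /orP[//|GJ_apart] := gap_inset_or_apart adm i p.
by have := inset_not_apart (gap_lt thick i p) GJ; rewrite GJ_apart.
Qed.

End GapFamilies.

Section Reindexing.
Variables (R : realFieldType) (I P Q : Type) (f : Q -> P).
Variables (x : I -> R) (G : I -> P -> R * R).

Lemma thick_gaps_reindex : injective f -> thick_gaps x G ->
  thick_gaps x (fun i q => G i (f q)).
Proof.
move=> f_inj [x_ge0 G_lt G_apart]; split=> // i p q pq.
by apply: G_apart => /f_inj.
Qed.

Lemma admissible_reindex J : admissible x G J ->
  admissible x (fun i q => G i (f q)) J.
Proof. by case=> J_le GJ J_len; split=> // j k p; exact: J_len. Qed.

End Reindexing.

Section RemovingOneGap.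
Variables (R : realFieldType) (I : finType) (P : eqType).
Variables (x : I -> R) (G : I -> P -> R * R).
Hypothesis thick : thick_gaps x G.
Variables (J : I -> R * R) (k : I) (p : P).
Hypotheses (adm : admissible x G J) (p_in : inset 0 (G k p) (J k)).

Lemma le_len_gap_others : 1 <= \sum_i x i / (x i + 1) ->
  len (G k p) <= \sum_(j | j != k) len (J j).
Proof.
rewrite (bigD1 k)//= => sum_ge1.
have xk_ge0 := ratio_ge0 thick k; have Gkp_lt := gap_lt thick k p.
apply: le_trans (ler_sum _ (fun j _ => le_len_admissible adm j p_in)).
rewrite -mulr_suml.
have {1}-> : len (G k p) = (1 - x k / (x k + 1)) * weight x G k p.
  by rewrite /weight; field; lra.
by rewrite ler_wpM2r ?mulr_ge0//; lra.
Qed.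

Variable K : R * R.
Hypothesis bridgeK : is_bridge (J k) (G k p) K.

Let J' : I -> R * R := [eta J with k |-> K].

Lemma inset_remove_gap i : inset 0 (J' i) (J i).
Proof.
rewrite /J' /=; case: eqVneq => [->|_]; last by rewrite /inset !addr0 !lexx.
exact: inset_bridge (ltW (gap_lt thick k p)) p_in bridgeK.
Qed.

Hypothesis p_max : forall i q, inset 0 (G i q) (J i) ->
  weight x G i q <= weight x G k p.

Lemma gap_inset_or_apart_bridge q :
  inset (x k * len (G k q)) (G k q) K || apart 0 (G k q) K.
Proof.
have [->|/eqP qp] := eqVneq q p; first by rewrite (apart_bridge bridgeK) orbT.
have Gkp_le := ltW (gap_lt thick k p).
have K_J : inset 0 K (J k) := inset_bridge Gkp_le p_in bridgeK.
have /orP[q_in|q_out] := gap_inset_or_apart adm k q; last first.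
  by rewrite orbC apartC (inset_apart K_J)// apartC.
have xk_ge0 := ratio_ge0 thick k.
have q_in0 := le_inset (ratio_len_ge0 thick k q) q_in.
have le_qp : len (G k q) <= len (G k p).
  by rewrite -(ler_pM2l (_ : 0 < x k + 1)); [exact: p_max | lra].
have pq_apart : apart (x k * len (G k q)) (G k q) (G k p).
  by have := gaps_apart thick k qp; rewrite (min_idPl le_qp).
exact: bridge_inset_or_apart (ratio_len_ge0 thick k q) Gkp_le bridgeK q_in
  pq_apart.
Qed.

Lemma admissible_remove_gap : admissible x G J'.
Proof.
have len_K := le_len_bridge (admissible_inset thick adm p_in) bridgeK.
split=> [i|i q|j i q q_in].
- rewrite /J' /=; case: eqVneq => [_|_]; last exact: admissible_le adm i.
  by rewrite -subr_ge0; exact: le_trans (ratio_len_ge0 thick k p) len_K.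
- rewrite /J' /=; case: eqVneq => [->|_]; last first.
    exact: gap_inset_or_apart adm i q.
  exact: gap_inset_or_apart_bridge.
- have {}q_in := inset_trans q_in (inset_remove_gap i).
  rewrite /J' /=; case: eqVneq => [->|_]; last first.
    exact: (le_len_admissible adm).
  apply: le_trans len_K; rewrite -(ratio_weight thick).
  have xk_ge0 := ratio_ge0 thick k.
  by rewrite ler_wpM2l ?p_max ?divr_ge0//; lra.
Qed.

End RemovingOneGap.

Section FinitelyManyGaps.
Variables (R : realFieldType) (I P : finType).
Variables (x : I -> R) (G : I -> P -> R * R).
Hypotheses (thick : thick_gaps x G) (sum_ge1 : 1 <= \sum_i x i / (x i + 1)).

Definition gaps_inside (J : I -> R * R) : {set I * P} :=
  [set q | inset 0 (G q.1 q.2) (J q.1)]%SET.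

Lemma gaps_inside_remove_gap J k p K :
  (k, p) \in gaps_inside J -> is_bridge (J k) (G k p) K ->
  gaps_inside [eta J with k |-> K] \proper gaps_inside J.
Proof.
rewrite inE/= => p_in bridgeK; apply/properP; split.
  apply/fintype.subsetP => -[i q]; rewrite !inE => /inset_trans; apply.
  exact: (inset_remove_gap thick p_in bridgeK).
exists (k, p); rewrite !inE//= eqxx.
exact: contraL (inset_not_apart (gap_lt thick k p)) (apart_bridge bridgeK).
Qed.

Lemma sum_itv_gap_avoiding_fin J s : admissible x G J ->
  s \in closed_itv (sum_itv J) ->
  exists2 y, gap_avoiding G J y & s = \sum_i y i.
Proof.
have [N] := ubnP #|gaps_inside J|; elim: N J => // N IH J leN adm s_in.
have [inside0|[kp0 kp0_in]] := set_0Vmem (gaps_inside J).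
  have [y yJ sy] := sum_itv_decompose (admissible_le adm) s_in.
  exists y => // i; split=> // p; apply: apart_notin_open (yJ i).
  have := gap_inset_or_apart adm i p; case/orP => // p_in.
  have : (i, p) \in gaps_inside J.
    by rewrite inE; exact: le_inset (ratio_len_ge0 thick i p) p_in.
  by rewrite inside0 inE.
have [[k p] kp_in kp_max] := arg_maxP (fun q => weight x G q.1 q.2) kp0_in.
have {}kp_in : (k, p) \in gaps_inside J := kp_in.
have p_in : inset 0 (G k p) (J k) by rewrite inE in kp_in.
have [K bridgeK s_in'] :=
  sum_itv_remove_gap (le_len_gap_others thick adm p_in sum_ge1) s_in.
have adm' : admissible x G [eta J with k |-> K].
  apply: (admissible_remove_gap thick adm p_in bridgeK) => i q q_in.
  have iq_in : (i, q) \in gaps_inside J by rewrite inE.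
  exact: kp_max iq_in.
have lt_inside := proper_card (gaps_inside_remove_gap kp_in bridgeK).
have [y y_avoid sy] := IH _ (leq_trans lt_inside leN) adm' s_in'.
exists y => // i; have [yJ' yG] := y_avoid i; split=> //.
exact: mem_inset (inset_remove_gap thick p_in bridgeK i) yJ'.
Qed.

End FinitelyManyGaps.

Lemma compact_bigcapI (T : ptopologicalType) (P : choiceType) (A : set T)
    (F : P -> set T) :
  compact A -> (forall p, closed (F p)) ->
  (forall D : {fset P}, A `&` \bigcap_(p in [set` D]) F p !=set0) ->
  A `&` \bigcap_p F p !=set0.
Proof.
rewrite compact_In0 => cptA clF meetF.
have [[p0 _]|P0] := pselect (exists p : P, True); last first.
  have [v [Av _]] := meetF fset0.
  by exists v; split=> // p; case: P0; exists p.
have [|D _|v AFv] := cptA P setT (fun p => A `&` F p).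
- by exists F.
- have [v [Av Fv]] := meetF D.
  by exists v => p pD; split=> //; exact: Fv.
- by exists v; split=> [|p _]; [have [] := AFv p0 I | have [] := AFv p I].
Qed.

Section Boxes.
Variables (R : realType) (n : nat) (J : 'I_n -> R * R).

Lemma compact_sum_box s :
  compact ([set v : 'rV[R]_n | forall i, v ord0 i \in closed_itv (J i)] `&`
           [set v : 'rV[R]_n | \sum_i v ord0 i = s]).
Proof.
apply: compact_closedI.
  exact: (rV_compact (fun i => @segment_compact R (J i).1 (J i).2)).
have sum_continuous : continuous (fun v : 'rV[R]_n => \sum_i v ord0 i).
  apply: continuous_big => [|i _]; first exact: add_continuous.
  exact: coord_continuous.
exact: ((continuous_closedP _).1 sum_continuous [set s] (@closed_eq R s)).
Qed.

Lemma closed_notin_open_itv :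
  closed [set v : 'rV[R]_n | forall i, v ord0 i \notin open_itv (J i)].
Proof.
rewrite (_ : mkset _ = \bigcap_(i in [set: 'I_n])
  ((fun v : 'rV[R]_n => v ord0 i) @^-1` ~` [set` open_itv (J i)])).
  apply: closed_bigI => i _; apply: (continuous_closedP _).1.
    exact: coord_continuous.
  exact/open_closedC/interval_open.
by apply/seteqP; split=> v vG i; [move=> _; exact/negP | exact/negP/vG].
Qed.

End Boxes.

Section ArbitrarilyManyGaps.
Variables (R : realType) (n : nat) (P : Type).
Variables (x : 'I_n -> R) (G : 'I_n -> P -> R * R).

Lemma sum_itv_gap_avoiding J s : thick_gaps x G ->
  1 <= \sum_i x i / (x i + 1) -> admissible x G J ->
  s \in closed_itv (sum_itv J) ->
  exists2 y, gap_avoiding G J y & s = \sum_i y i.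
Proof.
move=> thick sum_ge1 adm s_in.
have [|v [[vJ vs] vG]] := compact_bigcapI (P := {classic P})
    (@compact_sum_box _ _ J s) (fun p => @closed_notin_open_itv _ _ (G^~ p)).
  move=> D; pose f (p : D) : P := val p.
  have thickD := thick_gaps_reindex (f := f) val_inj thick.
  have admD := admissible_reindex f adm.
  have [y y_avoid sy] := sum_itv_gap_avoiding_fin thickD sum_ge1 admD s_in.
  exists (\row_i y i); split; last first.
    by move=> p pD i; rewrite mxE; have [_ /(_ [` pD]%fset)] := y_avoid i.
  split=> [i|/=]; first by rewrite mxE; have [] := y_avoid i.
  by rewrite sy; apply: eq_bigr => i _; rewrite mxE.
by exists (fun i => v ord0 i) => // i; split=> // p; exact: vG.
Qed.

End ArbitrarilyManyGaps.

Definition child (b : bool) (p : positive) : positive :=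
  if b then xI p else xO p.

Lemma positive_child_ind (Q : positive -> Prop) :
  Q xH -> (forall b p, Q p -> Q (child b p)) -> forall p, Q p.
Proof.
move=> Q1 Qchild; elim=> // p; [exact: Qchild true p | exact: Qchild false p].
Qed.

Inductive descendant (q : positive) : positive -> Prop :=
| descendant_refl : descendant q q
| descendant_child b p : descendant q p -> descendant q (child b p).

Lemma descendant_root p : descendant xH p.
Proof.
elim/positive_child_ind: p => [|b p]; first exact: descendant_refl.
exact: descendant_child.
Qed.

Lemma descendant_cases q p : descendant q p ->
  p = q \/ exists b, descendant (child b q) p.
Proof.
elim=> [|b p' _ [->|[c p'_c]]]; [by left | right; exists b | right; exists c].
- exact: descendant_refl.
- exact: descendant_child.
Qed.

Section CantorGaps.
Variables (R : realType) (I1 : R * R) (g : R * R -> R * R).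
Hypothesis cantorI : is_cantor_data I1 g.

Local Notation bridge := (bridge I1 g).
Local Notation gap := (gap I1 g).
Local Notation ratio := (density_ratio I1 g).

Lemma is_bridge_child b p : is_bridge (bridge p) (gap p) (bridge (child b p)).
Proof. by case: b; [right | left]. Qed.

Lemma gap_endpoints_lt p : (gap p).1 < (gap p).2.
Proof. by have [] := cantorI.2 p. Qed.

Lemma gap_inset_bridge p : inset 0 (gap p) (bridge p).
Proof. by have [? _ ?] := cantorI.2 p; rewrite /inset; lra. Qed.

Lemma bridge_descendant q p : descendant q p -> inset 0 (bridge p) (bridge q).
Proof.
elim=> [|b p' _]; first by rewrite /inset !addr0 !lexx.
apply: inset_trans.
apply: inset_bridge (is_bridge_child b p').
- exact/ltW/gap_endpoints_lt.
- exact: gap_inset_bridge.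
Qed.

Lemma siblings_apart b p :
  apart 0 (bridge (child b p)) (bridge (child (~~ b) p)).
Proof.
by case: b; rewrite /apart/=; have := gap_endpoints_lt p; rewrite /gap; lra.
Qed.

Lemma descendant_or_apart p q :
  [\/ descendant p q, descendant q p | apart 0 (bridge p) (bridge q)].
Proof.
elim/positive_child_ind: p => [|b p [pq|qp|pq]].
- by constructor 1; exact: descendant_root.
- have [->|[c cp_q]] := descendant_cases pq.
    by constructor 2; exact/descendant_child/descendant_refl.
  have [eq_cb|ne_cb] := eqVneq c b; first by constructor 1; rewrite -eq_cb.
  constructor 3; rewrite apartC; apply: inset_apart (bridge_descendant cp_q) _.
  have -> : b = ~~ c by case: b c ne_cb {cp_q} => [] [].
  exact: siblings_apart.
- by constructor 2; exact: descendant_child.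
- constructor 3; apply: inset_apart pq; apply: bridge_descendant.
  exact/descendant_child/descendant_refl.
Qed.

Lemma gap_apart_descendant p q : descendant p q -> p <> q ->
  apart 0 (gap p) (bridge q).
Proof.
move=> /descendant_cases[->//|[b /bridge_descendant bq] _].
rewrite apartC (inset_apart bq)// apartC.
exact: apart_bridge (is_bridge_child b p).
Qed.

Lemma gap_apart_bridge p q : p <> q ->
  apart 0 (gap p) (bridge q) \/ apart 0 (gap q) (bridge p).
Proof.
move=> pq; case: (descendant_or_apart p q) => [p_q|q_p|pq_apart].
- by left; exact: gap_apart_descendant.
- by right; apply: gap_apart_descendant q_p _ => /esym.
- by left; exact: inset_apart (gap_inset_bridge p) pq_apart.
Qed.

Definition bridge_gap_ratio p : R :=
  Num.min (itvlen (bridge (xO p))) (itvlen (bridge (xI p))) / itvlen (gap p).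

Lemma bridge_gap_ratio_ge0 p : 0 <= bridge_gap_ratio p.
Proof.
have [] := cantorI.2 p; rewrite /bridge_gap_ratio /itvlen /gap/= => ? ? ?.
by rewrite divr_ge0 ?le_min ?subr_ge0 ?ltW.
Qed.

Lemma density_ratio_ge0 : 0 <= ratio.
Proof.
apply: lb_le_inf; first by eexists; exists xH.
by move=> _ [p _ <-]; exact: bridge_gap_ratio_ge0.
Qed.

Lemma density_ratio_le p : ratio <= bridge_gap_ratio p.
Proof.
apply: ge_inf; last by exists p.
by exists 0 => _ [q _ <-]; exact: bridge_gap_ratio_ge0.
Qed.

Lemma gap_inset_density p : inset (ratio * len (gap p)) (gap p) (bridge p).
Proof.
have := density_ratio_le p.
rewrite ler_pdivlMr ?subr_gt0 ?gap_endpoints_lt// le_min.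
by rewrite /itvlen /inset /gap/= => /andP[]; lra.
Qed.

Lemma gaps_apart_density p q : p <> q ->
  apart (ratio * Num.min (len (gap p)) (len (gap q))) (gap p) (gap q).
Proof.
have apart_of p' q' : apart 0 (gap p') (bridge q') ->
    apart (ratio * len (gap q')) (gap q') (gap p').
  by rewrite apartC; exact/inset_apart/gap_inset_density.
have ratio_ge0 := density_ratio_ge0.
move=> /gap_apart_bridge[/apart_of|/apart_of]; [rewrite apartC|];
  by apply: le_apart; rewrite ler_wpM2l// ge_min lexx ?orbT.
Qed.

Lemma gap_inset_root p : inset (ratio * len (gap p)) (gap p) I1.
Proof.
apply: inset_trans (gap_inset_density p) _.
exact: bridge_descendant (descendant_root p).
Qed.

Lemma scaled_len_gap_le p :
  (ratio + 1) * len (gap p) <= (ratio + 1) / (2 * ratio + 1) * len I1.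
Proof.
have := density_ratio_ge0; have := le_len_inset (gap_inset_root p).
rewrite -mulrA => ? ?; rewrite ler_wpM2l//; first lra.
by rewrite mulrC ler_pdivlMr; lra.
Qed.

End CantorGaps.

Lemma cantor_setP (R : realType) (I1 : R * R) (g : R * R -> R * R) (y : R) :
  cantor_set I1 g y <->
  y \in closed_itv I1 /\ forall p, y \notin open_itv (gap I1 g p).
Proof.
split=> -[yI y_avoid]; split=> //.
- by move=> p; apply/negP => y_gap; apply: y_avoid; exists p.
- by move=> [p _ y_gap]; have := y_avoid p; rewrite (y_gap : y \in _).
Qed.

Section CantorFamilies.
Variables (R : realType) (I : Type).
Variables (I1 : I -> R * R) (g : I -> R * R -> R * R).
Hypothesis cantorI : forall i, is_cantor_data (I1 i) (g i).

Local Notation ratio i := (density_ratio (I1 i) (g i)).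
Local Notation gaps := (fun i => gap (I1 i) (g i)).

Lemma cantor_thick_gaps : thick_gaps (fun i => ratio i) gaps.
Proof.
split=> [i|i p|i p q]; [exact: density_ratio_ge0 | exact: gap_endpoints_lt |].
exact: gaps_apart_density.
Qed.

Lemma cantor_admissible :
  (forall j k, ratio j / (ratio j + 1) * ((ratio k + 1) / (2 * ratio k + 1)) *
    itvlen (I1 k) <= itvlen (I1 j)) ->
  admissible (fun i => ratio i) gaps I1.
Proof.
move=> len_ge; split=> [i|i p|j k p _]; first by have [/ltW] := cantorI i.
  by rewrite gap_inset_root.
apply: le_trans (len_ge j k); rewrite -[leRHS]mulrA.
have ratio_ge0 := density_ratio_ge0 (cantorI j).
rewrite ler_wpM2l ?divr_ge0//; [lra | exact: scaled_len_gap_le].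
Qed.

End CantorFamilies.

Theorem theorem3p7 (R : realType) (n : nat)
  (I1 : 'I_n -> R * R) (g : 'I_n -> R * R -> R * R) (x : 'I_n -> R)
  (hC : forall i : 'I_n, is_cantor_data (I1 i) (g i))
  (hx : forall i : 'I_n, density_ratio (I1 i) (g i) = x i)
  (hsum : 1 <= \sum_(i < n) x i / (x i + 1))
  (hlen : forall j k : 'I_n,
     x j / (x j + 1) * ((x k + 1) / (2 * x k + 1)) * itvlen (I1 k)
       <= itvlen (I1 j)) :
  clitv (\sum_(i < n) (I1 i).1, \sum_(i < n) (I1 i).2) =
  [set s : R | exists y : 'I_n -> R,
     (forall i : 'I_n, cantor_set (I1 i) (g i) (y i)) /\
     s = \sum_(i < n) y i].
Proof.
have {hx} xE : x = fun i => density_ratio (I1 i) (g i) by apply/funext => i.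
rewrite {}xE in hsum hlen.
apply/seteqP; split=> s /=.
- have thick := cantor_thick_gaps hC.
  have adm := cantor_admissible hC hlen.
  move=> s_in; have [y y_avoid ->] := sum_itv_gap_avoiding thick hsum adm s_in.
  by exists y; split=> // i; exact/cantor_setP.
- move=> [y [yC ->]]; apply: mem_sum_itv => i.
  by have /cantor_setP[] := yC i.
Qed.
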